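(* (1) A matrix $A \in M_{2n\times 2n}(\mathbb{C})$ is normal, per-Hermitian and perplectic diagonalizable if and only if $A = N + N^\star$ for some normal matrix $N \in M_{2n\times 2n}(\mathbb{C})$ with $NN^\star = N^\star N = 0$. (2) A matrix $A \in M_{2n\times 2n}(\mathbb{C})$ is normal, perskew-Hermitian and perplectic diagonalizable if and only if $A = N - N^\star$ for some normal matrix $N \in M_{2n\times 2n}(\mathbb{C})$ satisfying $NN^\star = N^\star N = 0$.
   Context: $M_{2n\times 2n}(\mathbb{C})$ is the space of complex $2n\times 2n$ matrices and $A^H=\overline{A}^T$ is the Hermitian transpose. $A$ is normal if $A^HA=AA^H$. $R_n$ is the $n\times n$ matrix with ones on the antidiagonal and zeros elsewhere, and $R_{2n} = \begin{bmatrix} 0 & R_n \\ R_n & 0\end{bmatrix}$. For $X \in M_{2n\times 2n}(\mathbb{C})$, $X^\star := R_{2n}^{-1}X^HR_{2n} = R_{2n} X^H R_{2n}$ is the adjoint of $X$ with respect to the form $[x,y]=x^HR_{2n}y$. $A$ is per-Hermitian if $A^\star=A$, and perskew-Hermitian if $A^\star=-A$. A matrix $S \in M_{2n\times 2n}(\mathbb{C})$ is perplectic if $S^H R_{2n} S = R_{2n}$. $A$ is perplectic diagonalizable if there is a perplectic matrix $S$ such that $S^{-1}AS$ is diagonal. *)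

(* Defs.v *)
From mathcomp Require Export all_boot all_order all_algebra.
From mathcomp Require Export spectral complex reals.

Set Implicit Arguments.
Unset Strict Implicit.
Unset Printing Implicit Defensive.

Import Order.TTheory GRing.Theory Num.Theory.
Local Open Scope ring_scope.
Local Open Scope sesquilinear_scope.

Section Perplectic.
Variables (C : numClosedFieldType) (n : nat).

Definition antidiag_mx (m : nat) : 'M[C]_m :=
  \matrix_(i, j) (j == rev_ord i)%:R.

Definition form_mx : 'M[C]_(n + n) :=
  block_mx 0 (antidiag_mx n) (antidiag_mx n) 0.

(* The adjoint X^star with respect to the form [x, y] = x^H R_{2n} y,
   where R_{2n} is form_mx. *)
Definition star (X : 'M[C]_(n + n)) : 'M[C]_(n + n) :=
  invmx form_mx *m X ^t* *m form_mx.

Definition per_hermitian (A : 'M[C]_(n + n)) : Prop := star A = A.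

Definition perskew_hermitian (A : 'M[C]_(n + n)) : Prop := star A = - A.

Definition perplectic (S : 'M[C]_(n + n)) : Prop :=
  S ^t* *m form_mx *m S = form_mx.

(* A perplectic S is invertible, so invmx S is its genuine inverse. *)
Definition perplectic_diagonalizable (A : 'M[C]_(n + n)) : Prop :=
  exists2 S : 'M[C]_(n + n), perplectic S & is_diag_mx (invmx S *m A *m S).

End Perplectic.

(* Main.v *)
Require Import Defs.
From mathcomp Require Import zify.

(* If a perplectic S diagonalizes the normal matrix A, the unitary factor Q of
   the polar decomposition S = QP is again perplectic and diagonalizes A to the
   same diagonal D; then N is obtained from Q D Q^H by zeroing the last n
   diagonal entries. Conversely N N^star = 0 says that the row space of N is
   isotropic for the form. It extends to an n-dimensional isotropic space with
   an orthonormal basis U (as rows), on which the normal matrix N is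
   diagonalized; the basis and its image under R_{2n} form a matrix that is
   both unitary and perplectic and that diagonalizes N + N^star. The skew case
   is the same with N + c N^star, c = -1. *)

Set Implicit Arguments.
Unset Strict Implicit.
Unset Printing Implicit Defensive.

Import Order.TTheory GRing.Theory Num.Theory Num.Def.
Local Open Scope ring_scope.
Local Open Scope sesquilinear_scope.

(** * Normal matrices, intertwining relations and inverse square roots *)

Section ConjugateTranspose.
Variable C : numClosedFieldType.

Lemma ctmxM m n p (A : 'M[C]_(m, n)) (B : 'M_(n, p)) :
  (A *m B)^t* = B^t* *m A^t*.
Proof. by rewrite trmx_mul map_mxM. Qed.

Lemma ctmxD m n (A B : 'M[C]_(m, n)) : (A + B)^t* = A^t* + B^t*.
Proof. by apply/matrixP => i j; rewrite !mxE rmorphD. Qed.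

Lemma ctmxZ m n a (A : 'M[C]_(m, n)) : (a *: A)^t* = a^* *: A^t*.
Proof. by apply/matrixP => i j; rewrite !mxE rmorphM. Qed.

Lemma ctmx0 m n : (0 : 'M[C]_(m, n))^t* = 0.
Proof. by rewrite trmx0 map_mx0. Qed.

Lemma ctmx1 n : (1%:M : 'M[C]_n)^t* = 1%:M.
Proof. by rewrite trmx1 map_mx1. Qed.

Lemma ctmx_diag n (d : 'rV[C]_n) : (diag_mx d)^t* = diag_mx (map_mx conjC d).
Proof. by rewrite tr_diag_mx map_diag_mx. Qed.

Lemma ctmx_unit n (M : 'M[C]_n) : (M^t* \in unitmx) = (M \in unitmx).
Proof. by rewrite map_unitmx unitmx_tr. Qed.

Lemma unitary_ctmxK m n (U : 'M[C]_(m, n)) :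
  U \is unitarymx -> U *m U^t* = 1%:M.
Proof. by move/unitarymxP. Qed.

Lemma unitary_ctmxKl n (U : 'M[C]_n) : U \is unitarymx -> U^t* *m U = 1%:M.
Proof. by move=> /unitarymxP/mulmx1C. Qed.

Lemma unitary_diag_normal n (Q : 'M[C]_n) (D : 'M[C]_n) :
  Q \is unitarymx -> is_diag_mx D -> Q *m D *m Q^t* \is normalmx.
Proof.
move=> Qu /diag_mxP[d ->]; apply/normalmxP.
rewrite !ctmxM trmxCK !mulmxA ![_ *m Q^t* *m Q]mulmxKtV //.
by rewrite ctmx_diag -!(mulmxA Q) diag_mxC.
Qed.

(** Entrywise the hypothesis forces [a 0 i = b 0 j] wherever [X i j] is nonzero, so any function [f]
    whatsoever may be applied to both sides. This serves as the functional calculus below. *)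
Lemma diag_mx_intertwine (f : C -> C) m n (a : 'rV[C]_m) (b : 'rV[C]_n) X :
  diag_mx a *m X = X *m diag_mx b ->
  diag_mx (map_mx f a) *m X = X *m diag_mx (map_mx f b).
Proof.
rewrite !mul_diag_mx !mul_mx_diag => /matrixP eqX.
apply/matrixP => i j; have := eqX i j; rewrite !mxE.
have [-> _|nz] := eqVneq (X i j) 0; first by rewrite mul0r mulr0.
by rewrite [RHS]mulrC => /(mulIf nz) ->; rewrite mulrC.
Qed.

(** In a unitary eigenbasis of [A] the hypothesis relates two diagonal matrices, so
    [diag_mx_intertwine] applies with conjugation as [f]. *)
Lemma normal_eigen_ctmx m n (A : 'M[C]_m) (X : 'M[C]_(m, n)) (d : 'rV[C]_n) :
  A \is normalmx -> A *m X = X *m diag_mx d ->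
  A^t* *m X = X *m (diag_mx d)^t*.
Proof.
move=> /orthomx_spectralP; set U := spectralmx A; set a := spectral_diag A.
have Uu : U \is unitarymx := spectral_unitarymx A.
rewrite invmx_unitary // => -> AX.
have aX : diag_mx a *m (U *m X) = (U *m X) *m diag_mx d.
  by rewrite -[RHS]mulmxA -AX !mulmxA (unitary_ctmxK Uu) mul1mx.
have := diag_mx_intertwine conjC aX; rewrite -!ctmx_diag => acX.
by rewrite !ctmxM trmxCK -!mulmxA acX !mulmxA (unitary_ctmxKl Uu) mul1mx.
Qed.

Lemma normal_ker_ctmx m n (A : 'M[C]_m) (X : 'M[C]_(m, n)) :
  A \is normalmx -> A *m X = 0 -> A^t* *m X = 0.
Proof.
move=> An AX; have := @normal_eigen_ctmx _ _ A X 0 An.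
by rewrite linear0 ctmx0 !mulmx0; apply.
Qed.

(* The witness is the inverse of the positive square root of S^t* S. *)
Lemma gram_inv_sqrt n (S : 'M[C]_n) (H := S^t* *m S) : S \in unitmx ->
  exists P : 'M[C]_n, [/\ P^t* = P, P *m H *m P = 1%:M,
    forall X, H *m X = X *m H -> P *m X = X *m P
    & forall X, H *m X *m H = X -> P *m X *m P = X].
Proof.
move=> Su.
have Hn : H \is normalmx by apply/normalmxP; rewrite ctmxM trmxCK.
have := orthomx_spectralP Hn; set U := spectralmx H; set l := spectral_diag H.
have Uu : U \is unitarymx := spectral_unitarymx H.
rewrite invmx_unitary // => HE.
have UU := unitary_ctmxK Uu; have UU' := unitary_ctmxKl Uu.
(* Being the Gram matrix of the invertible [S *m U^t*], [diag_mx l] has positive diagonal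
   entries. *)
have lE : diag_mx l = (S *m U^t*)^t* *m (S *m U^t*).
  rewrite ctmxM trmxCK -mulmxA (mulmxA (S^t*)) -/H HE.
  by rewrite !mulmxA UU mul1mx -mulmxA UU mulmx1.
have l_ge0 i : 0 <= l 0 i.
  have /matrixP/(_ i i) := lE; rewrite !mxE eqxx mulr1n => ->.
  by apply: sumr_ge0 => k _; rewrite !mxE mulrC mul_conjC_ge0.
have l_neq0 i : l 0 i != 0.
  have : diag_mx l \in unitmx.
    by rewrite lE unitmx_mul ctmx_unit unitmx_mul Su ctmx_unit unitarymx_unit.
  by rewrite unitmxE det_diag unitfE => /prodf_neq0/(_ i isT).
pose r x : C := (sqrtC x)^-1; pose p := map_mx r l; pose q := map_mx sqrtC l.
have r_real i : (r (l 0 i))^* = r (l 0 i).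
  by apply/conj_Creal/ger0_real; rewrite invr_ge0 sqrtC_ge0.
have qp : diag_mx q *m diag_mx p = 1%:M.
  rewrite mulmx_diag -diag_const_mx; congr diag_mx; apply/rowP => i.
  by rewrite !mxE divff // sqrtC_eq0.
have lp : diag_mx l *m diag_mx p = diag_mx q.
  rewrite mulmx_diag; congr diag_mx; apply/rowP => i; rewrite !mxE /r.
  by rewrite -{1}[l 0 i]sqrtCK expr2 mulfK // sqrtC_eq0.
have conjU (X Y : 'M[C]_n) :
    U *m (X *m Y) *m U^t* = (U *m X *m U^t*) *m (U *m Y *m U^t*).
  by rewrite !mulmxA [_ *m U^t* *m U]mulmxKtV.
have injU (X Y : 'M[C]_n) : U *m X *m U^t* = U *m Y *m U^t* -> X = Y.
  move=> /(congr1 (fun Z => U^t* *m Z *m U)).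
  by rewrite !mulmxA UU' !mul1mx -!mulmxA UU' !mulmx1.
have UK X : U *m (U^t* *m X *m U) *m U^t* = X.
  by rewrite !mulmxA UU mul1mx -mulmxA UU mulmx1.
have UHU : U *m H *m U^t* = diag_mx l by rewrite HE UK.
(* From here on [P] is known only by its diagonal form [p], and each claim is checked after
   conjugation by [U]. *)
clearbody H; have [P UPU] : exists P, U *m P *m U^t* = diag_mx p.
  by exists (U^t* *m diag_mx p *m U).
exists P; split.
- apply: injU; have -> : U *m P^t* *m U^t* = (U *m P *m U^t*)^t*.
    by rewrite !ctmxM trmxCK mulmxA.
  rewrite UPU ctmx_diag.
  by congr diag_mx; apply/rowP => i; rewrite !mxE r_real.
- by apply: injU; rewrite !conjU UPU UHU -mulmxA lp mulmx1 UU diag_mxC.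
- move=> X HX; apply: injU; rewrite !conjU UPU.
  apply: diag_mx_intertwine; have := congr1 (fun Z => U *m Z *m U^t*) HX.
  by rewrite !conjU UHU.
move=> X HX; apply: injU; rewrite !conjU UPU; set Y := U *m X *m U^t*.
have YE : diag_mx l *m Y *m diag_mx l = Y.
  by have := congr1 (fun Z => U *m Z *m U^t*) HX; rewrite !conjU UHU.
have l_inv : diag_mx l *m diag_mx (map_mx (@GRing.inv _) l) = 1%:M.
  rewrite mulmx_diag -diag_const_mx; congr diag_mx; apply/rowP => i.
  by rewrite !mxE divff.
(* The relation [H *m X *m H = X] is read as intertwining [l] with its inverse. Applying [r]
   intertwines [p] with [q], since [r] sends the inverse of [x] to the square root of [x]. *)
have : diag_mx l *m Y = Y *m diag_mx (map_mx (@GRing.inv _) l).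
  by rewrite -[in RHS]YE -[RHS]mulmxA l_inv mulmx1.
move=> /(diag_mx_intertwine r) ->.
suff -> : map_mx r (map_mx (@GRing.inv _) l) = q.
  by rewrite -mulmxA qp mulmx1.
by apply/rowP => i; rewrite !mxE /r rootCV // invrK.
Qed.

(** Gram-Schmidt on a row base; the rank is a variable [r] so that [U] gets the expected number of
    rows without a cast. *)
Lemma orthonormal_row_basis m n r (A : 'M[C]_(m, n)) : \rank A = r ->
  exists2 U : 'M[C]_(r, n), U \is unitarymx & (U :=: A)%MS.
Proof.
move=> <-; exists (schmidt (row_base A)).
  by rewrite schmidt_unitarymx // rank_leq_col.
apply: eqmx_trans (eq_row_base A).
by apply: eqmx_schmidt_free; exact: row_base_free.
Qed.

End ConjugateTranspose.

(** * The form, its adjoint, and unitary perplectic matrices *)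

Section Form.
Variables (C : numClosedFieldType) (n : nat).
Local Notation J := (antidiag_mx C n).
Local Notation R := (form_mx C n).

Lemma mulmx_antidiag m (X : 'M[C]_(m, n)) i j : (X *m J) i j = X i (rev_ord j).
Proof.
rewrite mxE (bigD1 (rev_ord j)) //= mxE rev_ordK eqxx mulr1 big1 ?addr0 //.
move=> k nk; rewrite mxE; case: eqP => [jE|]; last by rewrite mulr0.
by move: nk; rewrite jE rev_ordK eqxx.
Qed.

Lemma antidiag_sqr : J *m J = 1%:M.
Proof.
by apply/matrixP => i j; rewrite mulmx_antidiag !mxE (inj_eq rev_ord_inj) eq_sym.
Qed.

Lemma antidiag_ct : J^t* = J.
Proof.
apply/matrixP => i j; rewrite !mxE conjC_nat; congr (_ %:R); congr nat_of_bool.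
by apply/eqP/eqP => ->; rewrite rev_ordK.
Qed.

Lemma antidiag_conj_diag (d : 'rV[C]_n) : is_diag_mx (J *m diag_mx d *m J).
Proof.
apply/is_diag_mxP => i j ij; rewrite mulmx_antidiag mul_mx_diag !mxE.
by rewrite (inj_eq rev_ord_inj) eq_sym -val_eqE (negPf ij) mul0r.
Qed.

Lemma form_sqr : R *m R = 1%:M.
Proof.
by rewrite mulmx_block !mul0mx !mulmx0 antidiag_sqr !addr0 !add0r -scalar_mx_block.
Qed.

Lemma form_ct : R^t* = R.
Proof. by rewrite tr_block_mx map_block_mx !antidiag_ct !trmx0 !map_mx0. Qed.

Lemma starE (X : 'M[C]_(n + n)) : star X = R *m X^t* *m R.
Proof.
rewrite /star; congr (_ *m _ *m _); have [Ru _] := mulmx1_unit form_sqr.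
by rewrite -[RHS]mul1mx -(mulVmx Ru) -mulmxA form_sqr mulmx1.
Qed.

Lemma starK : involutive (@star C n).
Proof.
move=> X; rewrite !starE !ctmxM trmxCK form_ct !mulmxA form_sqr mul1mx.
by rewrite -mulmxA form_sqr mulmx1.
Qed.

Lemma starD (X Y : 'M[C]_(n + n)) : star (X + Y) = star X + star Y.
Proof. by rewrite !starE ctmxD mulmxDr mulmxDl. Qed.

Lemma starZ a (X : 'M[C]_(n + n)) : star (a *: X) = a^* *: star X.
Proof. by rewrite !starE ctmxZ -scalemxAr -scalemxAl. Qed.

(** The left inverse [R *m S^t* *m R] of [S] is also a right inverse, so [S^t*] is perplectic
    too. *)
Lemma perplectic_mul_ct (S : 'M[C]_(n + n)) :
  perplectic S -> S *m R *m S^t* = R.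
Proof.
move=> SP; have : (R *m S^t* *m R) *m S = 1%:M.
  by rewrite -!mulmxA (mulmxA (S^t*)) SP form_sqr.
move=> /mulmx1C; rewrite !mulmxA => E.
by rewrite -[LHS]mulmx1 -form_sqr mulmxA E mul1mx.
Qed.

Lemma perplectic_unit (S : 'M[C]_(n + n)) : perplectic S -> S \in unitmx.
Proof.
move=> SP; have [] := @mulmx1_unit _ _ (R *m S^t* *m R) S => //.
by rewrite -!mulmxA (mulmxA (S^t*)) SP form_sqr.
Qed.

(** Let [H = S^t* *m S] and let [P] be its inverse square root. Perplecticity gives
    [H *m R *m H = R], hence [P *m R *m P = R], and normality makes [H], hence [P], commute with
    [D]. So [S *m P] is unitary, perplectic and yields the same [D]. *)
Lemma unitary_perplectic_diag (A : 'M[C]_(n + n)) :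
  A \is normalmx -> perplectic_diagonalizable A ->
  exists Q : 'M[C]_(n + n),
    [/\ Q \is unitarymx, perplectic Q & is_diag_mx (Q^t* *m A *m Q)].
Proof.
move=> An [S SP]; set D := _ *m S => Dd; have Su := perplectic_unit SP.
have AS : A *m S = S *m D by rewrite /D !mulmxA mulmxV // mul1mx.
have AcS : A^t* *m S = S *m D^t*.
  by move: AS; have /diag_mxP[d ->] := Dd => AS; apply: normal_eigen_ctmx.
have [P [Pct PHP Pcomm Pinv]] := gram_inv_sqrt Su.
(* Both sides equal [S^t* *m A *m S], by [AS] and by the adjoint of [AcS]. *)
have HD : (S^t* *m S) *m D = D *m (S^t* *m S).
  rewrite -mulmxA -AS mulmxA; have := congr1 (fun Z => Z^t*) AcS.
  by rewrite !ctmxM !trmxCK => ->; rewrite mulmxA.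
exists (S *m P); split.
- rewrite -trmxC_unitary; apply/unitarymxP.
  by rewrite trmxCK ctmxM Pct -PHP !mulmxA.
- rewrite /perplectic ctmxM Pct.
  have -> : P *m S^t* *m R *m (S *m P) = P *m (S^t* *m R *m S) *m P.
    by rewrite !mulmxA.
  rewrite SP; apply: Pinv.
  have -> : S^t* *m S *m R *m (S^t* *m S) = S^t* *m (S *m R *m S^t*) *m S.
    by rewrite !mulmxA.
  by rewrite perplectic_mul_ct.
suff -> : (S *m P)^t* *m A *m (S *m P) = D by [].
have -> : (S *m P)^t* *m A *m (S *m P) = P *m (S^t* *m (A *m S)) *m P.
  by rewrite ctmxM Pct !mulmxA.
rewrite AS (mulmxA _ S); move: (_ *m S) PHP HD Pcomm => H PHP HD Pcomm.
by rewrite -mulmxA -(mulmxA H) -Pcomm // !mulmxA PHP mul1mx.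
Qed.

Lemma split_of_perplectic_diag (c : C) (A : 'M[C]_(n + n)) :
    c * c = 1 -> A \is normalmx -> star A = c *: A ->
    perplectic_diagonalizable A ->
  exists N : 'M[C]_(n + n), [/\ N \is normalmx, N *m star N = 0,
    star N *m N = 0 & A = N + c *: star N].
Proof.
move=> c_sqr An As Apd.
have [Q [Qu QP]] := unitary_perplectic_diag An Apd.
set D := _ *m Q => /diag_mxP[d DE].
have QQ := unitary_ctmxK Qu; have QQ' := unitary_ctmxKl Qu.
have AE : A = Q *m D *m Q^t*.
  by rewrite /D !mulmxA QQ mul1mx -mulmxA QQ mulmx1.
(* Being unitary and perplectic, [Q] commutes with [R], so the adjoint can be computed on the
   diagonal matrix [D]. *)
have RQ : R *m Q = Q *m R by rewrite -[in RHS]QP !mulmxA QQ mul1mx.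
have QR : Q^t* *m R = R *m Q^t*.
  by have := congr1 (fun Z => Z^t*) RQ; rewrite !ctmxM form_ct.
have RD : R *m D^t* *m R = c *: D.
  rewrite /D !ctmxM trmxCK !mulmxA -QR -!mulmxA -RQ.
  have : R *m A^t* *m R = c *: A by rewrite -starE.
  move=> /(congr1 (fun Z => Q^t* *m Z *m Q)).
  by rewrite -!scalemxAr -!scalemxAl !mulmxA.
(* [E] and [F] project onto the first and last [n] coordinates, which [R] exchanges. The adjoint of
   the [E] part of [A] is therefore [c] times its [F] part. *)
pose e : 'rV[C]_(n + n) := row_mx (const_mx 1) 0.
pose f : 'rV[C]_(n + n) := row_mx 0 (const_mx 1).
pose E := diag_mx e; pose F := diag_mx f.
have EE : E = block_mx 1%:M 0 0 0.
  by rewrite /E /e diag_mx_row diag_const_mx (linear0 (@diag_mx _ _)).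
have FE : F = block_mx 0 0 0 1%:M.
  by rewrite /F /f diag_mx_row (linear0 (@diag_mx _ _)) diag_const_mx.
have RE : R *m E = F *m R.
  by rewrite EE FE !mulmx_block !mul0mx !mulmx0 !mulmx1 !mul1mx !addr0 !add0r.
have EF : E *m F = 0.
  by rewrite EE FE mulmx_block !mul0mx !mulmx0 !addr0 block_mx0.
have FE0 : F *m E = 0.
  by rewrite EE FE mulmx_block !mul0mx !mulmx0 !addr0 block_mx0.
have sumEF : E + F = 1%:M.
  by rewrite EE FE add_block_mx !addr0 add0r -scalar_mx_block.
have Ect : E^t* = E.
  by rewrite EE tr_block_mx map_block_mx !trmx0 !map_mx0 ctmx1.
have DEc : D *m E = E *m D by rewrite DE /E diag_mxC.
have DFc : D *m F = F *m D by rewrite DE /F diag_mxC.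
exists (Q *m (D *m E) *m Q^t*).
have -> : star (Q *m (D *m E) *m Q^t*) = c *: (Q *m (D *m F) *m Q^t*).
  rewrite starE; have -> : R *m (Q *m (D *m E) *m Q^t*)^t* *m R
      = Q *m (R *m E *m D^t* *m R) *m Q^t*.
    by rewrite !ctmxM trmxCK Ect !mulmxA RQ -(mulmxA _ (Q^t*) R) QR !mulmxA.
  by rewrite RE -!(mulmxA F) RD -!scalemxAr -scalemxAl DFc.
have cancelQ (X Y : 'M[C]_(n + n)) :
    (Q *m X *m Q^t*) *m (Q *m Y *m Q^t*) = Q *m (X *m Y) *m Q^t*.
  by rewrite !mulmxA [_ *m Q^t* *m Q]mulmxKtV.
split.
- by apply: unitary_diag_normal => //; rewrite DE /E mulmx_diag diag_mx_is_diag.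
- rewrite -scalemxAr cancelQ DFc !mulmxA -(mulmxA _ E F) EF.
  by rewrite mulmx0 !mul0mx scaler0.
- rewrite -scalemxAl cancelQ DEc !mulmxA -(mulmxA _ F E) FE0.
  by rewrite mulmx0 !mul0mx scaler0.
by rewrite scalerA c_sqr scale1r -mulmxDl -!mulmxDr sumEF mulmx1.
Qed.

(** * Isotropic subspaces of maximal dimension *)

Lemma form_isotropic_first : (row_mx 1%:M 0 : 'M[C]_(n, n + n)) *m R
  *m (row_mx 1%:M 0 : 'M[C]_(n, n + n))^t* = 0.
Proof.
rewrite mul_row_block !mul0mx !mulmx0 mul1mx !addr0.
by rewrite tr_row_mx map_col_mx mul_row_col trmx0 map_mx0 mul0mx mulmx0 addr0.
Qed.

(** [R] swaps the two halves, so orthogonality to the first [n] basis vectors kills the right half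
    of a row, up to the invertible factor [J]. *)
Lemma form_ortho_first :
  (kermx (R *m (row_mx 1%:M 0 : 'M[C]_(n, n + n))^t*)
     :=: (row_mx 1%:M 0 : 'M[C]_(n, n + n)))%MS.
Proof.
apply/eqmxP/andP; split; last by rewrite sub_kermx mulmxA form_isotropic_first.
set K := kermx _; have : K *m (R *m (row_mx 1%:M 0 : 'M[C]_(n, n + n))^t*) = 0.
  exact: mulmx_ker.
rewrite -[K]hsubmxK tr_row_mx map_col_mx mul_block_col trmx0 map_mx0 ctmx1.
rewrite !mulmx0 !mulmx1 !addr0 mul_row_col mulmx0 add0r => KJ.
have -> : rsubmx K = 0 by rewrite -[LHS]mulmx1 -antidiag_sqr mulmxA KJ mul0mx.
by rewrite -[X in row_mx X _]mulmx1 -(mulmx0 _ (lsubmx K)) -mul_mx_row submxMl.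
Qed.

(* With L0 the span of the first n basis vectors, which is its own orthogonal
   for the form, the sum of X and of the part of L0 orthogonal to X is
   isotropic, and of rank n by the modular identities for ranks. *)
Lemma lagrangian_extension m (X : 'M[C]_(m, n + n)) : X *m R *m X^t* = 0 ->
  exists U : 'M[C]_(n, n + n),
    [/\ U \is unitarymx, U *m R *m U^t* = 0 & (X <= U)%MS].
Proof.
move=> XX; pose L0 : 'M[C]_(n, n + n) := row_mx 1%:M 0.
pose K := kermx (R *m X^t*); pose Y := (L0 :&: K)%MS.
have YX : Y *m R *m X^t* = 0.
  by rewrite -mulmxA; apply/sub_kermxP; exact: capmxSr.
have XY : X *m R *m Y^t* = 0.
  have := congr1 (fun Z => Z^t*) YX.
  by rewrite !ctmxM trmxCK form_ct ctmx0 mulmxA.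
have YY : Y *m R *m Y^t* = 0.
  have /submxP[Z ->] : (Y <= L0)%MS by exact: capmxSl.
  rewrite ctmxM -!mulmxA (mulmxA R) (mulmxA L0) (mulmxA L0).
  by rewrite form_isotropic_first mul0mx mulmx0.
pose L := col_mx Y X.
have LL : L *m R *m L^t* = 0.
  by rewrite mul_col_mx tr_col_mx map_row_mx mul_col_row YY YX XY XX block_mx0.
have rL0 : \rank L0 = n.
  apply: mxrank_unitary; apply/unitarymxP.
  by rewrite tr_row_mx map_col_mx mul_row_col ctmx1 mul1mx mul0mx addr0.
have rL : \rank L = n.
  (* As [X] is isotropic it lies in its own orthogonal [K], so intersecting with [K] changes nothing
     inside [X]. *)
  have capE : \rank (Y :&: X)%MS = \rank (X :&: L0)%MS.
    have YL0 : (Y <= L0)%MS by exact: capmxSl.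
    have XK : (X <= K)%MS by rewrite sub_kermx mulmxA XX.
    apply/eqmx_rank/andP; rewrite !sub_capmx capmxSr capmxSl capmxSr /=.
    rewrite (submx_trans (capmxSl _ _) YL0).
    by rewrite (submx_trans (capmxSl _ _) XK).
  have := mxrank_sum_cap Y X; rewrite addsmxE -/L capE.
  have := mxrank_mul_ker L0 (R *m X^t*); rewrite -/K -/Y rL0.
  have := mxrank_mul_ker X (R *m L0^t*).
  rewrite (cap_eqmx (eqmx_refl X) form_ortho_first) -/L0.
  (* The pairings of [L0] with [X] and of [X] with [L0] are conjugate transposes of each other;
     their common rank cancels in the count. *)
  have -> : \rank (L0 *m (R *m X^t*)) = \rank (X *m (R *m L0^t*)).
    by rewrite -mxrank_tr -(mxrank_map conjC) !ctmxM trmxCK form_ct mulmxA.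
  by move: (\rank _) (\rank _) (\rank _) (\rank _) => a b d e; lia.
have [U Uu UE] := orthonormal_row_basis rL; exists U; split => //.
  have /submxP[Z ->] : (U <= L)%MS by rewrite UE.
  by rewrite ctmxM -!mulmxA (mulmxA R) (mulmxA L) (mulmxA L) LL mul0mx mulmx0.
by rewrite UE /L -addsmxE addsmxSr.
Qed.

(** [N] is compressed to a normal [n] by [n] matrix [M] on an isotropic space containing its rows.
    Rotating the orthonormal basis [U] by a unitary [T] that diagonalizes [M] gives [V]; then [N] is
    diagonal on [V] and [star N] on the image of [V] under [R]. *)
Lemma perplectic_diag_of_split (c : C) (N : 'M[C]_(n + n)) :
    c^* = c -> c * c = 1 -> N \is normalmx -> N *m star N = 0 ->
    let A := N + c *: star N in
  [/\ A \is normalmx, star A = c *: A & perplectic_diagonalizable A].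
Proof.
move=> c_real c_sqr Nn NsN A.
have NRN : N *m R *m N^t* = 0.
  rewrite -[LHS]mulmx1 -form_sqr mulmxA.
  by move: NsN; rewrite starE !mulmxA => ->; rewrite mul0mx.
have [U [Uu URU NU]] := lagrangian_extension NRN.
have UU := unitary_ctmxK Uu.
have NP : N *m (U^t* *m U) = N.
  by have /submxP[Y ->] := NU; rewrite !mulmxA -(mulmxA Y) UU mulmx1.
(* Normality carries [N *m (1 - U^t* *m U) = 0] over to [N^t*]; taking adjoints moves the projection
   to the left of [N]. *)
have PN : (U^t* *m U) *m N = N.
  have : N *m (1%:M - U^t* *m U) = 0 by rewrite mulmxBr mulmx1 NP subrr.
  move=> /(normal_ker_ctmx Nn); rewrite mulmxBr mulmx1 => /subr0_eq.
  by move=> /(congr1 (fun Z => Z^t*)); rewrite !ctmxM !trmxCK.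
pose M := U *m N *m U^t*.
have NE : N = U^t* *m M *m U by rewrite /M !mulmxA PN -mulmxA NP.
have Mn : M \is normalmx.
  apply/normalmxP; rewrite /M !ctmxM trmxCK.
  have -> : U *m N *m U^t* *m (U *m (N^t* *m U^t*))
      = U *m (N *m (U^t* *m U) *m N^t*) *m U^t* by rewrite !mulmxA.
  have -> : U *m (N^t* *m U^t*) *m (U *m N *m U^t*)
      = U *m (N^t* *m ((U^t* *m U) *m N)) *m U^t* by rewrite !mulmxA.
  by rewrite NP PN (normalmxP Nn).
have := orthomx_spectralP Mn; set T := spectralmx M; set l := spectral_diag M.
have Tu : T \is unitarymx := spectral_unitarymx M.
rewrite invmx_unitary // => ME.
pose V := T *m U.
have VV : V *m V^t* = 1%:M.
  by rewrite ctmxM mulmxA -(mulmxA T) UU mulmx1 unitary_ctmxK.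
have VRV : V *m R *m V^t* = 0.
  have -> : V *m R *m V^t* = T *m (U *m R *m U^t*) *m T^t*.
    by rewrite ctmxM !mulmxA.
  by rewrite URU mulmx0 mul0mx.
have NV : N = V^t* *m diag_mx l *m V by rewrite NE ME ctmxM !mulmxA.
clearbody V; have sNV : star N = R *m V^t* *m (diag_mx l)^t* *m V *m R.
  by rewrite starE NV !ctmxM trmxCK !mulmxA.
(* The factor [J] reverses the second half of the basis, so that the off-diagonal blocks of
   [S^t* *m R *m S] are [J] rather than the identity. *)
pose S : 'M[C]_(n + n) := row_mx (V^t*) (R *m V^t* *m J).
have Sct : S^t* = col_mx V (J *m V *m R).
  by rewrite /S tr_row_mx map_col_mx !ctmxM !trmxCK form_ct antidiag_ct mulmxA.
have SP : perplectic S.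
  rewrite /perplectic Sct mul_col_mx /S mul_col_row.
  rewrite !mulmxA -!(mulmxA _ R R) form_sqr !mulmx1 VRV VV mul1mx.
  by rewrite -!(mulmxA J) VV mulmx1 VRV mul0mx mulmx0.
have Su : S \is unitarymx.
  rewrite -trmxC_unitary; apply/unitarymxP; rewrite trmxCK Sct /S mul_col_row.
  rewrite !mulmxA VV VRV mul0mx -(mulmxA _ R R) form_sqr mulmx1.
  rewrite -!(mulmxA J) VRV mulmx0 VV mul1mx antidiag_sqr.
  by rewrite -scalar_mx_block.
pose D := block_mx (diag_mx l) 0 0 (c *: (J *m (diag_mx l)^t* *m J)).
have Dd : is_diag_mx D.
  rewrite is_diag_block_mx // !eqxx diag_mx_is_diag /= ctmx_diag.
  have /diag_mxP[x ->] := antidiag_conj_diag (map_mx conjC l).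
  by rewrite -linearZ diag_mx_is_diag.
have AE : A = S *m D *m S^t*.
  rewrite Sct /S mul_row_block !mulmx0 addr0 add0r mul_row_col.
  rewrite -NV -scalemxAr -scalemxAl; congr (_ + _ *: _).
  rewrite !mulmxA -(mulmxA _ J J) antidiag_sqr mulmx1.
  by rewrite -(mulmxA _ J J) antidiag_sqr mulmx1.
have As : star A = c *: A.
  by rewrite starD starZ starK c_real scalerDr scalerA c_sqr scale1r addrC.
split => //; first by rewrite AE; apply: unitary_diag_normal.
exists S => //; rewrite invmx_unitary ?unitarymx_unit //.
by rewrite AE !mulmxA (unitary_ctmxKl Su) mul1mx -mulmxA (unitary_ctmxKl Su) mulmx1.
Qed.

End Form.

(** * The two equivalences, as the cases [c = 1] and [c = -1] *)

Local Open Scope complex_scope.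

Theorem theorem7 (R : realType) (n : nat) :
  (forall A : 'M[R[i]]_(n + n),
     [/\ A \is normalmx, per_hermitian A & perplectic_diagonalizable A] <->
     (exists N : 'M[R[i]]_(n + n),
        [/\ N \is normalmx, N *m star N = 0, star N *m N = 0
          & A = N + star N])) /\
  (forall A : 'M[R[i]]_(n + n),
     [/\ A \is normalmx, perskew_hermitian A & perplectic_diagonalizable A] <->
     (exists N : 'M[R[i]]_(n + n),
        [/\ N \is normalmx, N *m star N = 0, star N *m N = 0
          & A = N - star N])).
Proof.
have N1_real : (-1 : R[i])^* = -1 by rewrite rmorphN1.
have N1_sqr : (-1 : R[i]) * -1 = 1 by rewrite mulrNN mulr1.
have one_real : (1 : R[i])^* = 1 by rewrite rmorph1.
have one_sqr : (1 : R[i]) * 1 = 1 by rewrite mulr1.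
split=> A; split.
- move=> [An As Apd].
  have := split_of_perplectic_diag one_sqr An _ Apd.
  rewrite scale1r => /(_ As)[N [? ? ? AE]].
  by exists N; split=> //; rewrite AE scale1r.
- move=> [N [Nn NsN _ ->]].
  by have [] := perplectic_diag_of_split one_real one_sqr Nn NsN; rewrite !scale1r.
- move=> [An As Apd].
  have := split_of_perplectic_diag N1_sqr An _ Apd.
  rewrite scaleN1r => /(_ As)[N [? ? ? AE]].
  by exists N; split=> //; rewrite AE scaleN1r.
move=> [N [Nn NsN _ ->]].
by have [] := perplectic_diag_of_split N1_real N1_sqr Nn NsN; rewrite !scaleN1r.
Qed.
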